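(* Let $n,m\ge1$. For $\mathcal{P}=(s_1,\ldots,s_n)\in\mathcal{L}_n^m$, let $i_0\in\{0,\ldots,n-1\}$ be the unique index such that $d_{i_0}(\mathcal{P})\in\mathcal{D}_n^m$. Then the map $h:\mathcal{L}_n^m\to\mathcal{D}_n^m\times\{0,1,\ldots,mn\}$ given by $h(\mathcal{P})=(d_{i_0}(\mathcal{P}),\,s_{i_0+1})$ is a bijection.
   Context: $\mathcal{L}_n^m$ is the set of lattice paths from $(0,0)$ to $(mn,n)$ using unit North $(0,1)$ and East $(1,0)$ steps, encoded by the step sequence $(s_1,\ldots,s_n)$ where $s_i$ is the number of East steps before the $i$-th North step ($0\le s_1\le\cdots\le s_n\le mn$). $\mathcal{D}_n^m\subseteq\mathcal{L}_n^m$ is the set of $m$-Dyck paths of height $n$, i.e. those with $s_i\le m(i-1)$ for all $i$ (paths never going below $y=x/m$). For $0\le i\le n-1$, with $\bar s_j=s_j+mn+1$, $d_i(\mathcal{P})$ is the path in $\mathcal{L}_n^m$ with step sequence $(0,\,s_{i+2}-s_{i+1},\ldots,s_n-s_{i+1},\,\bar s_1-s_{i+1},\ldots,\bar s_i-s_{i+1})$. It is known (and part of the same paper) that for each $\mathcal{P}$ exactly one $i_0$ has $d_{i_0}(\mathcal{P})\in\mathcal{D}_n^m$. *)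

(* Defs.v *)
From mathcomp Require Import all_boot.
From mathcomp Require Import zify.
Set Implicit Arguments.
Unset Strict Implicit.
Unset Printing Implicit Defensive.

(* A lattice path from (0,0) to (mn,n) is given by its step sequence
   s = [:: s_1; ...; s_n]; lists are indexed from 0, so s_i is nth 0 s (i - 1). *)
Definition is_lpath (m n : nat) (s : seq nat) : bool :=
  [&& size s == n, sorted leq s & all (fun x => x <= m * n) s].

Definition is_dyck (m n : nat) (s : seq nat) : bool :=
  is_lpath m n s && [forall j : 'I_n, nth 0 s j <= m * j].

Definition lpath (m n : nat) : Type := {s : seq nat | is_lpath m n s}.

Definition dyck (m n : nat) : Type := {s : seq nat | is_dyck m n s}.

(* The step sequence of d_i(P), for 0 <= i <= n - 1. On step sequences of
   lattice paths no subtraction below truncates. When s_i = s_(i+1) the last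
   entry is mn + 1, so the result is a bare sequence rather than an lpath; it is
   an lpath whenever it is a Dyck path. *)
Definition d (m n i : nat) (s : seq nat) : seq nat :=
  let a := nth 0 s i in
  0 :: [seq x - a | x <- drop i.+1 s]
    ++ [seq (x + m * n + 1) - a | x <- take i s].

Lemma lpath_size m n s : is_lpath m n s -> size s = n.
Proof. by case/and3P=> /eqP. Qed.

Lemma lpath_le m n s i : is_lpath m n s -> nth 0 s i <= m * n.
Proof.
case/and3P=> _ _ /allP H; case: (ltnP i (size s)) => hi.
  exact/H/mem_nth.
by rewrite nth_default.
Qed.

Lemma lpath_mono m n s i j :
  is_lpath m n s -> i <= j -> j < n -> nth 0 s i <= nth 0 s j.
Proof.
move=> L hij hj; have [/eqP hs so _] := and3P L.
apply: (sorted_leq_nth leq_trans leqnn 0 so) => //; rewrite inE hs //; lia.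
Qed.

Lemma size_d m n i s : is_lpath m n s -> i < n -> size (d m n i s) = n.
Proof.
move=> /lpath_size hs hi.
by rewrite /d /= size_cat !size_map size_drop size_takel hs; lia.
Qed.

Lemma nth_d m n i s j : is_lpath m n s -> i < n -> j < n ->
  nth 0 (d m n i s) j =
  if i + j < n then nth 0 s (i + j) - nth 0 s i
  else (nth 0 s (i + j - n) + m * n + 1) - nth 0 s i.
Proof.
move=> /lpath_size hs hi hj; rewrite /d; case: j hj => [|j] hj /=.
  by rewrite addn0 hi subnn.
rewrite nth_cat size_map size_drop hs; case: (ltnP j (n - i.+1)) => h.
  rewrite (nth_map 0) ?size_drop ?hs // nth_drop addnS addSn ifT //; lia.
rewrite ifF; last by lia.
rewrite (nth_map 0) ?size_takel ?hs; try lia.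
rewrite nth_take; last by lia.
by have -> : j - (n - i.+1) = i + j.+1 - n by lia.
Qed.

(* d_i(P) is Dyck iff i is the first index maximizing s_(i+1) - m i. *)
Lemma is_dyck_dP m n i s : is_lpath m n s -> i < n ->
  reflect (forall k, k < n ->
             nth 0 s k + m * (n - k) + (k < i) <= nth 0 s i + m * (n - i))
          (is_dyck m n (d m n i s)).
Proof.
move=> L hi; apply: (iffP idP).
  case/andP=> _ /forallP H k hk; case: (ltnP k i) => hki.
    have hj : n + k - i < n by lia.
    have := H (Ordinal hj); rewrite /= nth_d // ifF; last by lia.
    have -> : i + (n + k - i) - n = k by lia.
    have := lpath_le i L; nia.
  have hj : k - i < n by lia.
  have := H (Ordinal hj); rewrite /= nth_d // subnKC // ifT //; nia.
move=> H; have bnd j : j < n -> nth 0 (d m n i s) j <= m * j.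
  move=> hj; rewrite nth_d //; case: ifP => h.
    have := H _ h; nia.
  have hk : i + j - n < n by lia.
  have := H _ hk; have -> : (i + j - n < i) by lia.
  have := lpath_le i L; nia.
apply/andP; split; last by apply/forallP=> j; exact: bnd.
apply/and3P; split; first by rewrite size_d.
  apply/(sortedP 0) => j; rewrite size_d // => hj.
  rewrite !nth_d //; try lia.
  case: ifP => h1; case: ifP => h2; try lia.
  - have h : i + j <= i + j.+1 by lia.
    have := lpath_mono L h h2; lia.
  - have := lpath_le (i + j) L; lia.
  - have h : i + j - n <= i + j.+1 - n by lia.
    have h' : i + j.+1 - n < n by lia.
    have := lpath_mono L h h'; lia.
apply/(all_nthP 0) => j; rewrite size_d // => hj.
by apply: leq_trans (bnd _ hj) _; rewrite leq_mul2l; lia.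
Qed.

Lemma exists_unique_dyck m n (P : lpath m n) : 0 < n ->
  exists! i : 'I_n, is_dyck m n (d m n i (sval P)).
Proof.
case: P => s L /= hn; pose f k := nth 0 s k + m * (n - k).
pose i1 := [arg max_(i > Ordinal hn) f i].
have hmax (k : 'I_n) : f k <= f i1.
  by rewrite /i1; case: arg_maxnP => // i _; apply.
have ex : exists k, (k < n) && (f k == f i1) by exists i1; rewrite ltn_ord eqxx.
case: (ex_minnP ex) => i /andP[hi /eqP fi] mini.
exists (Ordinal hi); split.
  apply/is_dyck_dP => //= k hk; rewrite -/(f k) -/(f i) fi.
  have /= := hmax (Ordinal hk); case: (ltnP k i) => hki; last by lia.
  rewrite leq_eqVlt => /orP[e|]; last by lia.
  by have := mini k; rewrite hk e => /(_ isT); lia.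
move=> j /(is_dyck_dP L (ltn_ord j)) Hj; apply: val_inj => /=.
have := Hj _ hi; have := hmax j; have := mini j.
rewrite ltn_ord -/(f i) -/(f j) fi /=; case: (f j =P f i1) => [e /(_ isT)|]; lia.
Qed.

Lemma exists_dyck m n (hn : 0 < n) (P : lpath m n) :
  exists i : 'I_n, is_dyck m n (d m n i (sval P)).
Proof. by have [i [Hi _]] := exists_unique_dyck P hn; exists i. Qed.

Definition i0 m n (hn : 0 < n) (P : lpath m n) : 'I_n :=
  xchoose (exists_dyck hn P).

Lemma i0P m n (hn : 0 < n) (P : lpath m n) :
  is_dyck m n (d m n (i0 hn P) (sval P)).
Proof. exact: (xchooseP (exists_dyck hn P)). Qed.

Lemma i0_unique m n (hn : 0 < n) (P : lpath m n) (i : 'I_n) :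
  is_dyck m n (d m n i (sval P)) -> i = i0 hn P.
Proof.
have [j [_ Hj]] := exists_unique_dyck P hn => Hi.
by rewrite -(Hj _ Hi) -(Hj _ (i0P hn P)).
Qed.

Lemma step_bound m n (P : lpath m n) i : nth 0 (sval P) i < (m * n).+1.
Proof. exact: lpath_le (svalP P). Qed.

Definition h m n (hn : 0 < n) (P : lpath m n) : dyck m n * 'I_(m * n).+1 :=
  (exist _ (d m n (i0 hn P) (sval P)) (i0P hn P),
   Ordinal (step_bound P (i0 hn P))).

(* Main.v *)
Require Import Defs.
From mathcomp Require Import all_boot.
From mathcomp Require Import zify.
Set Implicit Arguments.
Unset Strict Implicit.

(** Adding [c = s_(i+1)] modulo [mn + 1] to the entries of [d_i(P)] gives a
    rotation of the step sequence of [P]; since that sequence is sorted, it is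
    determined by [d_i(P)] and [c]. Conversely, for a Dyck path [t] the entries
    with [t_j + c > mn] form a suffix of [t]; moving that suffix to the front,
    reduced by [mn + 1], yields a path mapped to [(t, c)]. *)

(** Adding [nth 0 s i] undoes the subtraction in [d] without truncation and leaves [x] or
    [x + m * n + 1] for an entry [x <= m * n] of [s]; both reduce to [x]. *)
Lemma rot_d m n i s : is_lpath m n s -> i < n ->
  [seq (x + nth 0 s i) %% (m * n).+1 | x <- d m n i s] = rot i s.
Proof.
move=> L hi; have hs := lpath_size L.
have hr : size (rot i s) = n by rewrite size_rot.
apply: (@eq_from_nth _ 0); first by rewrite size_map size_d ?hr.
move=> j; rewrite size_map size_d // => hj.
rewrite (nth_map 0) ?size_d // nth_d // /rot nth_cat size_drop hs.
case: ifP => h.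
  have -> : j < n - i by lia.
  have hij : i <= i + j by lia.
  have := lpath_mono L hij h => hle.
  by rewrite subnK // modn_small ?nth_drop // ltnS (lpath_le _ L).
have -> : j < n - i = false by lia.
rewrite nth_take; last by lia.
have -> : j - (n - i) = i + j - n by lia.
have := lpath_le i L; have := lpath_le (i + j - n) L => h1 h2.
rewrite subnK; last by lia.
by rewrite -addnA addn1 modnDr modn_small.
Qed.

Lemma sort_d m n i s : is_lpath m n s -> i < n ->
  sort leq [seq (x + nth 0 s i) %% (m * n).+1 | x <- d m n i s] = s.
Proof.
move=> L hi; rewrite rot_d //; have [_ so _] := and3P L.
apply: (sorted_eq leq_trans anti_leq) => //; first exact: sort_sorted leq_total _.
by rewrite perm_sort perm_rot.
Qed.

(** Sorting forgets the amount of rotation, so [P] and [Q] agree without any comparison of their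
    indices [i0]. *)
Lemma h_inj m n (hn : 0 < n) : injective (@h m n hn).
Proof.
move=> P Q e; apply: val_inj => /=.
have /= e1 := congr1 (fun y => sval y.1) e.
have /= e2 := congr1 (fun y => val y.2) e.
rewrite -(sort_d (svalP P) (ltn_ord (i0 hn P))).
by rewrite e1 e2 (sort_d (svalP Q) (ltn_ord (i0 hn Q))).
Qed.

Definition wrap_pos m n c (t : seq nat) := find (fun x => m * n < x + c) t.

(** For sorted [t] every entry from position [k] on overflows, so the subtraction is exact. If none
    overflows, [find] returns [size t] and nothing is moved. *)
Definition wrap m n c (t : seq nat) : seq nat :=
  let k := wrap_pos m n c t in
  [seq x + c - (m * n).+1 | x <- drop k t] ++ [seq x + c | x <- take k t].

Lemma wrap_pos_le m n c t : wrap_pos m n c t <= size t.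
Proof. exact: find_size. Qed.

(** [find] only locates the first overflow; monotonicity of [t] carries it to all later entries. *)
Lemma lt_wrap_pos m n c t j : is_lpath m n t -> j < n ->
  (j < wrap_pos m n c t) = (nth 0 t j + c <= m * n).
Proof.
move=> L hj; case: (ltnP j) => hk.
  by have := before_find 0 hk; lia.
have hkn : wrap_pos m n c t < n := leq_ltn_trans hk hj.
have /(nth_find 0) : has (fun x => m * n < x + c) t.
  by rewrite has_find (lpath_size L).
by rewrite -/(wrap_pos m n c t); have := lpath_mono L hk hj; lia.
Qed.

Lemma size_wrap m n c t : size (wrap m n c t) = size t.
Proof.
have := wrap_pos_le m n c t => hk.
by rewrite size_cat !size_map size_drop size_takel // subnK.
Qed.

Lemma nth_wrap m n c t j : j < size t ->
  nth 0 (wrap m n c t) j =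
  if j < size t - wrap_pos m n c t
  then nth 0 t (wrap_pos m n c t + j) + c - (m * n).+1
  else nth 0 t (j - (size t - wrap_pos m n c t)) + c.
Proof.
move=> hj; have := wrap_pos_le m n c t => hk.
rewrite nth_cat size_map size_drop; case: ifP => h.
  by rewrite (nth_map 0) ?size_drop // nth_drop.
rewrite (nth_map 0) ?size_takel //; last by lia.
by rewrite nth_take //; lia.
Qed.

Lemma wrap_lpath m n c t : c <= m * n -> is_lpath m n t ->
  is_lpath m n (wrap m n c t).
Proof.
move=> hc L; have hs := lpath_size L.
have := wrap_pos_le m n c t; rewrite hs => hk.
apply/and3P; split; first by rewrite size_wrap hs.
  apply/(sortedP 0) => j; rewrite size_wrap hs => hj.
  rewrite !nth_wrap ?hs; try lia.
  set k := wrap_pos m n c t in hk *.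
  case: ifP => h1; case: ifP => h2; try lia.
  - have a : k + j <= k + j.+1 by lia.
    have b : k + j.+1 < n by lia.
    by have := lpath_mono L a b; lia.
  (* At the junction, the last moved entry is below [c], while every unmoved one is at least [c]. *)
  - by have := lpath_le (k + j) L; lia.
  - have a : j - (n - k) <= j.+1 - (n - k) by lia.
    have b : j.+1 - (n - k) < n by lia.
    by have := lpath_mono L a b; lia.
apply/(all_nthP 0) => j; rewrite size_wrap hs => hj.
rewrite nth_wrap ?hs //; case: ifP => h.
  by have := lpath_le (wrap_pos m n c t + j) L; lia.
by rewrite -lt_wrap_pos //; lia.
Qed.

Lemma dyck_head m n t : 0 < n -> is_dyck m n t -> nth 0 t 0 = 0.
Proof.
move=> hn /andP[_ /forallP/(_ (Ordinal hn))] /=.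
by rewrite muln0 leqn0 => /eqP.
Qed.

(** A Dyck path starts with 0, which does not overflow. Hence [n - wrap_pos m n c t], where this
    entry lands in [wrap], is a legitimate index below [n]. *)
Lemma wrap_pos_gt0 m n c t : 0 < n -> c <= m * n -> is_dyck m n t ->
  0 < wrap_pos m n c t.
Proof.
move=> hn hc D; have /andP[L _] := D.
by rewrite (lt_wrap_pos _ L hn) (dyck_head hn D).
Qed.

Lemma nth_wrap_start m n c t : 0 < n -> c <= m * n -> is_dyck m n t ->
  nth 0 (wrap m n c t) (n - wrap_pos m n c t) = c.
Proof.
move=> hn hc D; have /andP[L _] := D; have hs := lpath_size L.
have k0 := wrap_pos_gt0 hn hc D.
by rewrite nth_wrap hs ?ltnn ?subnn ?(dyck_head hn D) //; lia.
Qed.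

Lemma d_wrap m n c t : 0 < n -> c <= m * n -> is_dyck m n t ->
  d m n (n - wrap_pos m n c t) (wrap m n c t) = t.
Proof.
move=> hn hc D; have /andP[L _] := D; have hs := lpath_size L.
have k0 := wrap_pos_gt0 hn hc D; have W := wrap_lpath hc L.
have := wrap_pos_le m n c t; rewrite hs => hk.
have hi : n - wrap_pos m n c t < n by lia.
apply: (@eq_from_nth _ 0); first by rewrite size_d.
move=> j; rewrite size_d // => hj.
rewrite nth_d // nth_wrap_start //; have := lt_wrap_pos c L hj => e.
case: ifP => h; rewrite nth_wrap ?hs; try lia.
  by rewrite ifF; [rewrite addKn addnK | lia].
(* Here [j] lies in the moved suffix: by [e] its entry overflows, so the [m * n + 1] removed by
   [wrap] is exactly what [d] adds back. *)
rewrite ifT; last by lia.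
have -> : wrap_pos m n c t + (n - wrap_pos m n c t + j - n) = j by lia.
by lia.
Qed.

Lemma wrap_lpath_dyck m n (y : dyck m n * 'I_(m * n).+1) :
  is_lpath m n (wrap m n y.2 (sval y.1)).
Proof.
by case: y => [[t D] c] /=; apply: wrap_lpath (ltn_ord c) _; case/andP: D.
Qed.

Definition h_inv m n (y : dyck m n * 'I_(m * n).+1) : lpath m n :=
  exist _ (wrap m n y.2 (sval y.1)) (wrap_lpath_dyck y).

Lemma h_invK m n (hn : 0 < n) : cancel (@h_inv m n) (@h m n hn).
Proof.
case=> [[t D] c]; have hc : c <= m * n := ltn_ord c.
have hi : n - wrap_pos m n c t < n by have := wrap_pos_gt0 hn hc D; lia.
have e := d_wrap hn hc D.
(* Rotating at [hi] gives the Dyck path [t], so uniqueness identifies this index with [i0]. *)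
have D' : is_dyck m n (d m n (Ordinal hi) (sval (h_inv (exist _ t D, c)))).
  by rewrite /= e.
rewrite /h; congr pair; apply: val_inj => /=; rewrite -(i0_unique hn D') //=.
exact: nth_wrap_start.
Qed.

Unset Implicit Arguments.

Theorem theorem3p3 (m n : nat) (hm : 0 < m) (hn : 0 < n) :
  bijective (@h m n hn).
Proof.
exists (@h_inv m n); last exact: h_invK.
(* Injectivity turns the right inverse into a left one. *)
by move=> P; apply: (@h_inj m n hn); rewrite h_invK.
Qed.
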